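(* Let $a\le b$ and $t$ be positive integers. \begin{itemize} \item[(i)] For any $a<b<t$ and $n$ we have $$\mathrm{ex}(n,K_{a,b},K_{1,t})\le \frac{n}{a+b}\left(\binom{t-1}{a}\binom{t-1}{b-1}+\binom{t-1}{b}\binom{t-1}{a-1}\right),$$ while for any $a<t$ and $n$ we have $$\mathrm{ex}(n,K_{a,a},K_{1,t})\le \frac{n}{2a}\binom{t-1}{a}\binom{t-1}{a-1}.$$ In particular, if $a\le b<t$ and $2t-2$ divides $n$, we have $\mathrm{ex}(n,K_{a,b},K_{1,t})=\mathcal{N}\left(K_{a,b},\frac{n}{2t-2}K_{t-1,t-1}\right)$. \item[(ii)] If $a<t\le \frac{8a}{7}+1$, then for every $n$, $$\mathrm{ex}(n,K_{a,a},K_{1,t})=\mathcal{N}\left(K_{a,a},\left\lfloor \tfrac{n}{2t-2}\right\rfloor K_{t-1,t-1}+K_{\lfloor p/2\rfloor,\lceil p/2\rceil}\right),$$ where $p=n-(2t-2)\left\lfloor \frac{n}{2t-2}\right\rfloor$. \item[(iii)] Let $2\le s<a\le b<t$ be integers. Then $\mathrm{ex}(n,K_{a,b},K_{s,t})=\Omega(n^{\frac{3}{2}-o(1)})$. \end{itemize}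
   Context: All graphs are finite and simple. For graphs $H,G$, $\mathcal{N}(H,G)$ denotes the number of (not necessarily induced) subgraphs of $G$ isomorphic to $H$ (unlabeled copies). A graph is $F$-free if it has no (not necessarily induced) subgraph isomorphic to $F$, and $\mathrm{ex}(n,H,F)=\max\{\mathcal{N}(H,G): G \text{ is an } n\text{-vertex } F\text{-free graph}\}$. $K_{a,b}$ is the complete bipartite graph with parts of sizes $a$ and $b$. $G+H$ denotes the vertex-disjoint union of $G$ and $H$, and $kG$ the vertex-disjoint union of $k$ copies of $G$. Asymptotic notation in (iii) is as $n\to\infty$ with $a,b,s,t$ fixed. *)

(* Defs.v *)
From HB Require Import structures.
From mathcomp Require Import all_boot.

Set Implicit Arguments.
Unset Strict Implicit.
Unset Printing Implicit Defensive.

Section SimpleGraph.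
Variable T : finType.

Definition simple_adj (A : {ffun T * T -> bool}) : bool :=
  [forall x, ~~ A (x, x)] && [forall x, forall y, A (x, y) == A (y, x)].

(* The adjacency relation is stored as a finite function, so that [sgraph T]
   is itself a finType and one can maximise over all graphs on [T]. *)
Record sgraph := SGraph { adjm : {ffun T * T -> bool}; _ : simple_adj adjm }.

HB.instance Definition _ := [isSub for adjm].
HB.instance Definition _ := [Finite of sgraph by <:].

Definition adj (G : sgraph) : rel T := fun x y => adjm G (x, y).

Lemma adj_irr (G : sgraph) : irreflexive (adj G).
Proof.
move=> x; apply/negbTE.
by have /andP[/forallP/(_ x)] := valP G.
Qed.

Lemma adj_sym (G : sgraph) : symmetric (adj G).
Proof.
move=> x y; apply/eqP.
by have /andP[_ /forallP/(_ x)/forallP/(_ y)] := valP G.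
Qed.

Section OfRel.
Variables (r : rel T) (irr_r : irreflexive r) (sym_r : symmetric r).

Lemma graph_of_subproof : simple_adj [ffun p => r p.1 p.2].
Proof.
apply/andP; split; first by apply/forallP=> x; rewrite ffunE /= irr_r.
by apply/forallP=> x; apply/forallP=> y; rewrite !ffunE /= sym_r.
Qed.

Definition graph_of : sgraph := SGraph graph_of_subproof.

Lemma graph_ofE : adj graph_of =2 r.
Proof. by move=> x y; rewrite /adj /= ffunE. Qed.

End OfRel.
End SimpleGraph.

Coercion adj : sgraph >-> rel.

Section Copies.
Variables S T : finType.

(* A pair [(W, D)] encodes the graph with vertex set [W] and adjacency [D];
   [D] has no edge leaving [W], so each subgraph has exactly one encoding. *)
Definition subgraph (P : {set T} * sgraph T) (G : sgraph T) : bool :=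
  [forall x, forall y, P.2 x y ==> [&& x \in P.1, y \in P.1 & G x y]].

Definition isomorphic (H : sgraph S) (P : {set T} * sgraph T) : bool :=
  [exists f : {ffun S -> T},
    [&& injectiveb f, f @: [set: S] == P.1
      & [forall x, forall y, H x y == P.2 (f x) (f y)]]].

Definition copies (H : sgraph S) (G : sgraph T) : {set {set T} * sgraph T} :=
  [set P | subgraph P G && isomorphic H P].

Definition ncopies (H : sgraph S) (G : sgraph T) : nat := #|copies H G|.

Definition free_of (F : sgraph S) (G : sgraph T) : bool := copies F G == set0.

End Copies.

(* The maximum of an empty family is 0; this does not arise as soon as [F] has
   an edge, the edgeless graph being then [F]-free. *)
Definition extremal (n : nat) (S U : finType) (H : sgraph S) (F : sgraph U) :
  nat := \max_(G : sgraph 'I_n | free_of F G) ncopies H G.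

Section CompleteBipartite.
Variables a b : nat.

Definition biclique_rel : rel ('I_a + 'I_b) := fun u v =>
  match u, v with
  | inl _, inr _ | inr _, inl _ => true
  | _, _ => false
  end.

Lemma biclique_irr : irreflexive biclique_rel. Proof. by case. Qed.
Lemma biclique_sym : symmetric biclique_rel. Proof. by case=> ? [] ?. Qed.

Definition biclique := graph_of biclique_irr biclique_sym.

End CompleteBipartite.

Section DisjointUnion.
Variables (S T : finType) (G : sgraph S) (H : sgraph T).

Definition gunion_rel : rel (S + T) := fun u v =>
  match u, v with
  | inl x, inl y => G x y
  | inr x, inr y => H x y
  | _, _ => false
  end.

Lemma gunion_irr : irreflexive gunion_rel.
Proof. by case=> x /=; exact: adj_irr. Qed.

Lemma gunion_sym : symmetric gunion_rel.
Proof. by case=> x [] y //=; exact: adj_sym. Qed.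

Definition gunion := graph_of gunion_irr gunion_sym.

End DisjointUnion.

Section Multiple.
Variables (k : nat) (T : finType) (G : sgraph T).

Definition gmult_rel : rel ('I_k * T) := fun u v =>
  (u.1 == v.1) && G u.2 v.2.

Lemma gmult_irr : irreflexive gmult_rel.
Proof. by move=> u; rewrite /gmult_rel adj_irr andbF. Qed.

Lemma gmult_sym : symmetric gmult_rel.
Proof. by move=> u v; rewrite /gmult_rel eq_sym adj_sym. Qed.

Definition gmult := graph_of gmult_irr gmult_sym.

End Multiple.

(* Main.v *)
Require Import Defs.
From mathcomp Require Import all_boot all_order all_algebra all_field.
From mathcomp Require Import zify ring.

(* A copy of K_{a,b} is a pair (A, B) of disjoint completely joined sets of
   sizes a and b, unique up to the exchange of A and B when a = b.

   (i) Put d = t - 1 and count the pairs together with a vertex of A: each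
   vertex lies in at most C(d, b) C(d-1, a-1) of them, so there are at most
   n C(d, a) C(d, b) / d pairs, as in disjoint copies of K_{d,d}.

   (ii) When 7d <= 8a, two copies of K_{a,a} that share a vertex overlap so much
   that sharing a vertex is transitive. The copies in one class have their
   sides in two disjoint sets U and W; there are at most C(|U|, a) C(|W|, a) of
   them and never more than C(d, a)^2. By log-concavity and convexity of
   binomials the classes are best packed as copies of K_{d,d} and one balanced
   remainder.

   (iii) The exponent 3/2 is attained, with eps = 0. Over a field F of order
   q = 2^k, join the points (y, w) and (x, v) of two copies of F^2 when
   w + v = x y - f(x) f(y). If f takes at most b values, two vertices have at
   most one common neighbour for each value, so there is no K_{2,b+1}. If C is
   a set of b values and f(y + c) = c for c in C and y in a set S, then each
   (x, y, z) in S x S x F gives a copy of K_{b,b}, with vertices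
   (y + c, z + x c) and (x + c, x y + y c - z), for c in C. A greedy choice of
   S has size at least q / b^2, so there are of order q^3 copies on 2 q^2
   vertices. *)

Set Implicit Arguments.
Unset Strict Implicit.
Unset Printing Implicit Defensive.

(** * Copies of bicliques as pairs of joined sets *)

Section Bicliques.
Variable T : finType.
Implicit Types (G : sgraph T) (A B : {set T}).

Definition nbhd G (x : T) : {set T} := [set y | G x y].

Definition joined G A B : bool := [forall x in A, B \subset nbhd G x].

Definition bipairs (a b : nat) G : {set {set T} * {set T}} :=
  [set P : {set T} * {set T} | [&& #|P.1| == a, #|P.2| == b & joined G P.1 P.2]].

Lemma joinedP G A B :
  reflect (forall x y, x \in A -> y \in B -> G x y) (joined G A B).
Proof.
apply: (iffP forall_inP) => [h x y xA yB | h x xA].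
  by have /subsetP/(_ _ yB) := h x xA; rewrite inE.
by apply/subsetP=> y yB; rewrite inE h.
Qed.

Lemma joined_sym G A B : joined G A B = joined G B A.
Proof. by apply/joinedP/joinedP => h x y xA yB; rewrite adj_sym h. Qed.

Lemma bipairsP a b G A B :
  reflect [/\ #|A| = a, #|B| = b & joined G A B] ((A, B) \in bipairs a b G).
Proof.
by rewrite inE /=; apply: (iffP and3P) => [[/eqP ? /eqP ?]|[-> ->]].
Qed.

Lemma bipairs_swap a b G A B :
  ((A, B) \in bipairs a b G) = ((B, A) \in bipairs b a G).
Proof. by rewrite !inE /= joined_sym andbCA. Qed.

Lemma joined_notin G A B x : joined G A B -> x \in A -> x \notin B.
Proof.
by move=> /joinedP h xA; apply/negP=> xB; have := h _ _ xA xB; rewrite adj_irr.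
Qed.

(** The conjunct [x != y] makes the relation irreflexive for arbitrary sets, so the encoding carries
    no proof of disjointness. *)
Definition join_rel A B : rel T := fun x y =>
  (x != y) && ((x \in A) && (y \in B) || (x \in B) && (y \in A)).

Lemma join_rel_irr A B : irreflexive (join_rel A B).
Proof. by move=> x; rewrite /join_rel eqxx. Qed.

Lemma join_rel_sym A B : symmetric (join_rel A B).
Proof.
move=> x y; rewrite /join_rel eq_sym; congr (_ && _).
by rewrite orbC [(y \in B) && _]andbC [(y \in A) && _]andbC.
Qed.

Definition join_graph A B : sgraph T :=
  graph_of (@join_rel_irr A B) (@join_rel_sym A B).

Definition join_subgraph (P : {set T} * {set T}) : {set T} * sgraph T :=
  (P.1 :|: P.2, join_graph P.1 P.2).

Lemma join_graphE G A B x y : joined G A B ->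
  join_graph A B x y = (x \in A) && (y \in B) || (x \in B) && (y \in A).
Proof.
move=> jAB; rewrite graph_ofE /join_rel; case: eqP => //= <-.
rewrite [(x \in B) && _]andbC orbb; apply/esym/negP=> /andP[xA].
by rewrite (negbTE (joined_notin jAB xA)).
Qed.

Lemma sgraph_eqP (G G' : sgraph T) : G =2 G' -> G = G'.
Proof. by move=> e; apply/val_inj/ffunP => -[x y]; apply: e. Qed.

Lemma copies_bicliqueE a b G :
  copies (biclique a b) G = join_subgraph @: bipairs a b G.
Proof.
apply/setP=> -[W D]; rewrite inE; apply/andP/imsetP => [[sub iso]|].
  have /existsP[f /and3P[/injectiveP injf /eqP /= fW]] := iso.
  move=> /forallP fD.
  have {}fD u v : biclique a b u v = D (f u) (f v).
    by have /forallP/(_ v)/eqP := fD u.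
  pose A := f @: [set inl i | i : 'I_a]; pose B := f @: [set inr j | j : 'I_b].
  have inA u : (f u \in A) = if u is inl _ then true else false.
    apply/imsetP/idP => [[_ /imsetP[i _ ->] /injf -> //]|].
    by case: u => // i _; exists (inl i) => //; apply: imset_f.
  have inB u : (f u \in B) = if u is inr _ then true else false.
    apply/imsetP/idP => [[_ /imsetP[i _ ->] /injf -> //]|].
    by case: u => // i _; exists (inr i) => //; apply: imset_f.
  have subP x y : D x y -> [&& x \in W, y \in W & G x y].
    by have /forallP/(_ x)/forallP/(_ y)/implyP := sub.
  have jAB : joined G A B.
    apply/joinedP => x y /imsetP[_ /imsetP[i _ ->] ->].
    move=> /imsetP[_ /imsetP[j _ ->] ->].
    have : D (f (inl i)) (f (inr j)) by rewrite -fD graph_ofE.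
    by move/subP/and3P=> [].
  exists (A, B).
    apply/bipairsP; split => //.
      by rewrite !card_imset ?card_ord // => ? ? [].
    by rewrite !card_imset ?card_ord // => ? ? [].
  have WE : W = A :|: B.
    apply/setP=> x; rewrite -fW inE; apply/imsetP/orP.
      by case=> -[i|j] _ ->; [left | right]; rewrite ?inA ?inB.
    by case=> /imsetP[u _ ->]; exists u.
  congr (_, _); rewrite /join_subgraph /= ?WE //; apply: sgraph_eqP => x y.
  rewrite (join_graphE _ _ jAB).
  have [/andP[]|nW] := boolP ((x \in W) && (y \in W)).
    rewrite -!fW => /imsetP[u _ ->] /imsetP[v _ ->].
    by rewrite -fD graph_ofE !inA !inB; case: u v => ? [].
  transitivity false.
    by apply/negP=> /subP/and3P[xW yW _]; rewrite xW yW in nW.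
  by apply/esym/negP; move: nW; rewrite WE !inE negb_and !negb_or;
    case/orP=> /andP[/negbTE-> /negbTE->]; rewrite ?andbF.
case=> -[A B] /bipairsP[cA cB jAB] [-> ->] /=; split.
  apply/forallP=> x; apply/forallP=> y; apply/implyP.
  rewrite /= (join_graphE _ _ jAB) !inE.
  move/joinedP: jAB => jAB.
  case/orP=> /andP[hx hy]; rewrite hx hy ?orbT /=; first by rewrite jAB.
  by rewrite adj_sym jAB.
(* Conversely, enumerations of [A] and [B] together give the isomorphism. *)
pose f : {ffun 'I_a + 'I_b -> T} := [ffun u : 'I_a + 'I_b => match u with
  | inl i => enum_val (cast_ord (esym cA) i)
  | inr j => enum_val (cast_ord (esym cB) j) end].
have fl i : f (inl i) \in A by rewrite ffunE enum_valP.
have fr i : f (inr i) \in B by rewrite ffunE enum_valP.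
have nAB x : x \in A -> (x \in B) = false.
  by move=> xA; apply/negbTE/(joined_notin jAB).
have fB i : (f (inl i) \in B) = false by rewrite nAB.
have fA i : (f (inr i) \in A) = false.
  by apply/negP=> /nAB; rewrite fr.
apply/existsP; exists f; apply/and3P; split.
- apply/injectiveP => -[i|i] [j|j] e.
  + by move: e; rewrite !ffunE => /enum_val_inj/cast_ord_inj->.
  + by have := fB i; rewrite e fr.
  + by have := fB j; rewrite -e fr.
  + by move: e; rewrite !ffunE => /enum_val_inj/cast_ord_inj->.
- apply/eqP/setP => x; rewrite inE; apply/imsetP/orP.
    by case=> -[i|i] _ ->; [left | right].
  case=> xI.
    exists (inl (cast_ord cA (enum_rank_in xI x))) => //.
    by rewrite ffunE cast_ordK enum_rankK_in.
  exists (inr (cast_ord cB (enum_rank_in xI x))) => //.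
  by rewrite ffunE cast_ordK enum_rankK_in.
- apply/forallP=> u; apply/forallP=> v; apply/eqP.
  rewrite (join_graphE _ _ jAB) graph_ofE.
  by case: u v => i [] j; rewrite /= ?fl ?fr ?fA ?fB.
Qed.

(** In the join graph a vertex of [A] has neighbourhood [B] and a vertex of [B] has neighbourhood
    [A], so nonempty sides can be read off up to exchange. *)
Lemma join_subgraph_eq G A B A' B' :
  joined G A B -> joined G A' B' -> A != set0 -> B != set0 ->
  join_subgraph (A, B) = join_subgraph (A', B') ->
  (A, B) = (A', B') \/ (A, B) = (B', A').
Proof.
move=> j j' /set0Pn[x xA] /set0Pn[y yB] e.
have /= eU := congr1 fst e; have eD := congr1 (fun P => adj P.2) e.
have {}eD u v : (u \in A) && (v \in B) || (u \in B) && (v \in A) =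
   (u \in A') && (v \in B') || (u \in B') && (v \in A').
  rewrite -(join_graphE _ _ j) -(join_graphE _ _ j').
  exact: (congr1 (fun r : rel T => r u v) eD).
have nx := negbTE (joined_notin j xA).
have ny : y \in A = false.
  by apply/negbTE/(@joined_notin G B A) => //; rewrite joined_sym.
have hB v : (v \in B) = (x \in A') && (v \in B') || (x \in B') && (v \in A').
  by rewrite -eD xA nx orbF.
have hA v : (v \in A) = (y \in A') && (v \in B') || (y \in B') && (v \in A').
  by rewrite -eD yB ny.
have : x \in A' :|: B' by rewrite -eU inE xA.
have yE := hB y; rewrite yB in yE.
have j'' : joined G B' A' by rewrite joined_sym.
rewrite inE; case/orP=> xI.
  have nx' := negbTE (joined_notin j' xI).
  rewrite xI nx' orbF /= in yE.
  have ny' := negbTE (joined_notin j'' (esym yE)).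
  by left; congr (_, _); apply/setP=> v; rewrite ?hA ?hB ?xI ?nx' -?yE ?ny' ?orbF.
have nx' := negbTE (joined_notin j'' xI).
rewrite xI nx' /= in yE.
have ny' := negbTE (joined_notin j' (esym yE)).
by right; congr (_, _); apply/setP=> v; rewrite ?hA ?hB ?xI ?nx' -?yE ?ny' ?orbF.
Qed.

(* A biclique with equal parts is encoded by two ordered pairs. *)
Lemma card_bipairs a b G : 0 < a -> 0 < b ->
  #|bipairs a b G| = (a == b).+1 * ncopies (biclique a b) G.
Proof.
move=> a_gt0 b_gt0; rewrite /ncopies copies_bicliqueE.
have key P Q : P \in bipairs a b G -> Q \in bipairs a b G ->
    join_subgraph P = join_subgraph Q -> P = Q \/ P = (Q.2, Q.1).
  case: P Q => A B [A' B'] /bipairsP[cA cB j] /bipairsP[_ _ j'].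
  by apply: join_subgraph_eq j j' _ _; rewrite -card_gt0 ?cA ?cB.
have [eab|nab] := eqVneq a b; last first.
  rewrite mul1n card_in_imset // => P Q hP hQ /(key _ _ hP hQ)[//|eP].
  move: hP hQ; rewrite eP; case: Q {eP} => A B /bipairsP[cB _ _].
  by case/bipairsP => _ cB' _; rewrite -cB -cB' eqxx in nab.
subst b; rewrite -sum1_card (partition_big_imset join_subgraph) /=.
rewrite mulnC -sum_nat_const; apply: eq_bigr => _ /imsetP[[A B] hP ->].
rewrite sum1dep_card.
have hP' : (B, A) \in bipairs a a G by rewrite bipairs_swap.
have /bipairsP[cA cB j] := hP.
transitivity #|[set (A, B); (B, A)]|.
  apply: eq_card => -[A' B']; rewrite in_set2 inE; apply/andP/orP; last first.
    by case=> /eqP->; split=> //; rewrite /join_subgraph /= setUC;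
      apply/eqP; congr (_, _); apply: sgraph_eqP => x y;
      rewrite !graph_ofE /join_rel [in RHS]orbC.
  by case=> hQ /eqP /(key _ _ hQ hP)[->|->]; rewrite eqxx; [left|right].
rewrite cards2; have [[eAB _]|//] := eqVneq (A, B) (B, A).
have /set0Pn[x xA] : A != set0 by rewrite -card_gt0 cA.
by have := joined_notin j xA; rewrite -eAB xA.
Qed.

Lemma free_bicliqueE a b G :
  free_of (biclique a b) G = (bipairs a b G == set0).
Proof. by rewrite /free_of copies_bicliqueE imset_eq0. Qed.

Lemma free_starP t G :
  reflect (forall x, #|nbhd G x| < t) (free_of (biclique 1 t) G).
Proof.
rewrite free_bicliqueE; apply: (iffP idP) => [/eqP h x | h].
  rewrite ltnNge; apply/negP=> /card_geqP[s [us ss sub]].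
  have /setP/(_ ([set x], [set y in s])) := h; rewrite [RHS]inE => /bipairsP[].
  split; rewrite ?cards1 // ?cardsE ?(card_uniqP us) //.
  by apply/joinedP=> u v; rewrite !inE => /eqP-> /sub; rewrite inE.
apply/set0Pn => -[[A B] /bipairsP[/eqP/cards1P[x ->] cB /joinedP j]].
have := h x; rewrite ltnNge -cB => /negP; apply.
by apply/subset_leq_card/subsetP => y yB; rewrite inE j // inE.
Qed.

End Bicliques.

(** * Transport of graphs along injections *)

Section Transport.
Variables (S T : finType) (f : S -> T).
Hypothesis f_inj : injective f.

Definition imset_pair (P : {set S} * {set S}) : {set T} * {set T} :=
  (f @: P.1, f @: P.2).

Lemma imset_pair_inj : injective imset_pair.
Proof.
by move=> [A B] [A' B'] [/(imset_inj f_inj)-> /(imset_inj f_inj)->].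
Qed.

Lemma imset_pair_bipairs a b (G : sgraph S) (H : sgraph T) :
  (forall x y, G x y -> H (f x) (f y)) ->
  imset_pair @: bipairs a b G \subset bipairs a b H.
Proof.
move=> hom; apply/subsetP=> _ /imsetP[[A B] /bipairsP[<- <- /joinedP j] ->].
apply/bipairsP; split; rewrite ?card_imset //.
by apply/joinedP=> _ _ /imsetP[x xA ->] /imsetP[y yB ->]; apply/hom/j.
Qed.

Lemma leq_bipairs_hom a b (G : sgraph S) (H : sgraph T) :
  (forall x y, G x y -> H (f x) (f y)) -> #|bipairs a b G| <= #|bipairs a b H|.
Proof.
move=> hom; rewrite -(card_imset _ imset_pair_inj).
exact/subset_leq_card/imset_pair_bipairs.
Qed.

Variable G : sgraph S.

Definition image_rel : rel T := fun u v =>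
  [exists x, exists y, [&& f x == u, f y == v & G x y]].

Lemma image_relP u v :
  reflect (exists x y, [/\ f x = u, f y = v & G x y]) (image_rel u v).
Proof.
apply: (iffP existsP) => [[x /existsP[y /and3P[/eqP ? /eqP ? ?]]]|].
  by exists x, y.
by case=> x [y [/eqP ? /eqP ? ?]]; exists x; apply/existsP; exists y; apply/and3P.
Qed.

Lemma image_rel_irr : irreflexive image_rel.
Proof.
move=> u; apply/image_relP => -[x [y [<- /f_inj->]]].
by rewrite adj_irr.
Qed.

Lemma image_rel_sym : symmetric image_rel.
Proof.
by move=> u v; apply/image_relP/image_relP => -[x [y [? ? ?]]];
  exists y, x; rewrite adj_sym.
Qed.

Definition image_graph : sgraph T := graph_of image_rel_irr image_rel_sym.

(** Both sides of a forbidden pair are nonempty, so each of its vertices has a neighbour and lies in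
    the image of [f]; the preimages form a pair of the same sizes in [G]. *)
Lemma free_image_graph s t : 0 < s -> 0 < t ->
  free_of (biclique s t) G -> free_of (biclique s t) image_graph.
Proof.
rewrite !free_bicliqueE => s_gt0 t_gt0; apply: contraTT.
case/set0Pn=> -[A B] /bipairsP[cA cB /joinedP j].
have [x0 x0A] : exists x, x \in A by apply/set0Pn; rewrite -card_gt0 cA.
have [y0 y0B] : exists y, y \in B by apply/set0Pn; rewrite -card_gt0 cB.
have codomA x : x \in A -> exists z, x = f z.
  move=> xA; have := j _ _ xA y0B; rewrite graph_ofE.
  by case/image_relP => z [_ [<- _ _]]; exists z.
have codomB y : y \in B -> exists z, y = f z.
  move=> yB; have := j _ _ x0A yB; rewrite graph_ofE.
  by case/image_relP => _ [z [_ <- _]]; exists z.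
have card_pre (C : {set T}) : (forall x, x \in C -> exists z, x = f z) ->
    #|f @^-1: C| = #|C|.
  move=> hC; rewrite -(card_imset _ f_inj); apply: eq_card => x.
  apply/imsetP/idP => [[z]|xC]; first by rewrite inE => ? ->.
  by have [z ez] := hC x xC; exists z; rewrite // inE -ez.
apply/set0Pn; exists (f @^-1: A, f @^-1: B).
apply/bipairsP; split; rewrite ?card_pre //.
apply/joinedP=> x y; rewrite !inE => xA yB; have := j _ _ xA yB.
by rewrite graph_ofE => /image_relP[? [? [/f_inj<- /f_inj<-]]].
Qed.

End Transport.

(** Constructions may thus live on any type with at most [n] elements; the remaining vertices of
    ['I_n] become isolated. *)
Lemma leq_extremal n a b s t (T : finType) (G : sgraph T) :
  0 < a -> 0 < b -> 0 < s -> 0 < t -> #|T| <= n ->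
  free_of (biclique s t) G ->
  ncopies (biclique a b) G <= extremal n (biclique a b) (biclique s t).
Proof.
move=> a_gt0 b_gt0 s_gt0 t_gt0 leTn freeG.
pose f (x : T) : 'I_n := widen_ord leTn (enum_rank x).
have f_inj : injective f.
  by move=> x y /(congr1 val) /= /val_inj /enum_rank_inj.
have homf x y : G x y -> image_graph f_inj G (f x) (f y).
  by move=> Gxy; rewrite graph_ofE; apply/image_relP; exists x, y.
have := leq_bipairs_hom f_inj a b homf.
rewrite !card_bipairs // leq_pmul2l // => /leq_trans; apply.
by apply: (bigmax_sup (image_graph f_inj G)) => //; apply: free_image_graph.
Qed.

(** * Counting pairs under a degree bound *)

Lemma double_count (S T : finType) (X : {set S}) (Y : {set T})
    (r : S -> T -> bool) :
  \sum_(x in X) #|[set y in Y | r x y]| = \sum_(y in Y) #|[set x in X | r x y]|.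
Proof.
under eq_bigr do rewrite -sum1dep_card big_mkcondr /=.
rewrite exchange_big /=; apply: eq_bigr => y _.
by rewrite -sum1dep_card big_mkcondr.
Qed.

Lemma leq_card_fibers (S T : finType) (X : {set S * T}) (P : {set S}) k :
  (forall p, p \in X -> p.1 \in P) ->
  (forall x, x \in P -> #|[set y | (x, y) \in X]| <= k) ->
  #|X| <= #|P| * k.
Proof.
move=> sub lek; rewrite -sum1_card (partition_big fst (mem P)) //=.
rewrite -sum_nat_const; apply: leq_sum => x xP.
apply: leq_trans (lek x xP); rewrite sum1dep_card.
rewrite -(@card_in_imset _ _ snd) => [|[x1 y1] [x2 y2]]; last first.
  by rewrite !inE /= => /andP[_ /eqP->] /andP[_ /eqP->] ->.
apply/subset_leq_card/subsetP => y /imsetP[[x1 y1]].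
by rewrite !inE /= => /andP[h /eqP <-] ->.
Qed.

Lemma leq_card_pointed_draws (T : finType) (D : {set T}) (x : T) k :
  0 < k ->
  #|[set A : {set T} | [&& x \in A, A \subset D & #|A| == k]]|
    <= 'C(#|D|.-1, k.-1).
Proof.
move=> k_gt0; have [xD|nxD] := boolP (x \in D); last first.
  rewrite eq_card0 // => A; rewrite !inE.
  by apply/and3P=> -[xA /subsetP/(_ _ xA)]; rewrite (negbTE nxD).
have -> : #|D|.-1 = #|D :\ x| by rewrite (cardsD1 x D) xD.
rewrite -cards_draws -(@card_in_imset _ _ (fun A => A :\ x)); last first.
  move=> A B; rewrite !inE => /and3P[xA _ _] /and3P[xB _ _] e.
  by rewrite -(setD1K xA) e setD1K.
apply/subset_leq_card/subsetP => _ /imsetP[A] + ->.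
rewrite !inE => /and3P[xA AD /eqP cA]; rewrite setSD //=.
by move: cA; rewrite (cardsD1 x A) xA => <-.
Qed.

Section Degree.
Variables (T : finType) (G : sgraph T) (d : nat).
Hypothesis degG : forall x, #|nbhd G x| <= d.

Definition common_nbhd (B : {set T}) : {set T} := \bigcap_(y in B) nbhd G y.

Lemma joined_common_nbhd A B : joined G A B -> A \subset common_nbhd B.
Proof.
move=> /joinedP j; apply/subsetP=> x xA; apply/bigcapP => y yB.
by rewrite inE adj_sym j.
Qed.

Lemma joined_nbhd A B x : joined G A B -> x \in A -> B \subset nbhd G x.
Proof. by move=> /joinedP j xA; apply/subsetP=> y yB; rewrite inE j. Qed.

(** Double counting of pairs with a vertex [x] of the left side. For fixed [x], the right side is a
    [b]-subset of the neighbourhood of [x], and the left side contains [x] and lies in a common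
    neighbourhood of size at most [e]. Both [e = d] and [e = d - 1] occur below. *)
Lemma bipairs_count_vertex a b e (O : {set {set T} * {set T}}) (U : {set T}) :
  0 < a -> O \subset bipairs a b G ->
  (forall A B, (A, B) \in O -> A \subset U /\ #|common_nbhd B| <= e) ->
  a * #|O| <= #|U| * ('C(d, b) * 'C(e.-1, a.-1)).
Proof.
move=> a_gt0 /subsetP sub hO.
have -> : a * #|O| = \sum_(P in O) #|[set x in U | x \in P.1]|.
  rewrite mulnC -sum_nat_const; apply: eq_bigr => -[A B] hP /=.
  have [AU _] := hO _ _ hP; have /bipairsP[<- _ _] := sub _ hP.
  apply: eq_card => x; rewrite inE.
  by case: (boolP (x \in A)) => [/(subsetP AU)->|]; rewrite ?andbF.
rewrite double_count -sum_nat_const; apply: leq_sum => x xU.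
pose X := [set P : {set T} * {set T} | ((P.2, P.1) \in O) && (x \in P.2)].
have -> : #|[set P in O | x \in P.1]| = #|X|.
  rewrite -(@card_imset _ _ (fun P : {set T} * {set T} => (P.2, P.1)) X).
    apply: eq_card => -[A B]; rewrite !inE /=.
    apply/andP/imsetP=> [[hO' xA]|[[A' B']]].
      by exists (B, A); rewrite // inE hO'.
    by rewrite inE /= => /andP[? ?] [-> ->].
  by move=> [? ?] [? ?] [-> ->].
pose Q := [set B : {set T} | B \subset nbhd G x & #|B| == b].
apply: (@leq_trans (#|Q| * 'C(e.-1, a.-1))); last first.
  by rewrite leq_mul2r cards_draws leq_bin2l ?degG ?orbT.
apply: leq_card_fibers => [[B A]|B _].
  rewrite !inE /= => /andP[hP xA]; have /bipairsP[_ -> j] := sub _ hP.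
  by rewrite (joined_nbhd j xA) eqxx.
(* The bound [e] is available only for a set [B] that occurs in [O], hence the separate case of an
   empty fibre. *)
have [->|/set0Pn[A0]] := eqVneq [set A | (B, A) \in X] set0.
  by rewrite cards0.
rewrite !inE /= => /andP[/hO[_ leCe] _].
apply: (@leq_trans 'C(#|common_nbhd B|.-1, a.-1)); last first.
  by apply: leq_bin2l; lia.
apply: leq_trans (leq_card_pointed_draws (common_nbhd B) x a_gt0).
apply/subset_leq_card/subsetP => A; rewrite !inE /= => /andP[hP xA].
have /bipairsP[-> _ j] := sub _ hP.
by rewrite xA joined_common_nbhd // eqxx.
Qed.

Lemma card_common_nbhd B : B != set0 -> #|common_nbhd B| <= d.
Proof.
case/set0Pn=> y yB; apply: leq_trans (degG y).
exact/subset_leq_card/bigcap_inf.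
Qed.

(** The identity [d * 'C(d.-1, a.-1) = a * 'C(d, a)] makes the incidence count symmetric in [a] and
    [b]. *)
Lemma leq_card_bipairs a b : 0 < a -> 0 < b ->
  d * #|bipairs a b G| <= #|T| * ('C(d, a) * 'C(d, b)).
Proof.
move=> a_gt0 b_gt0; rewrite -(leq_pmul2l a_gt0).
have h : a * #|bipairs a b G| <= #|T| * ('C(d, b) * 'C(d.-1, a.-1)).
  rewrite -cardsT; apply: bipairs_count_vertex => // A B /bipairsP[_ cB _].
  by split; rewrite ?subsetT // card_common_nbhd // -card_gt0 cB.
have := mul_bin_diag d a.-1; rewrite prednK // => e.
have /(leq_mul (leqnn d)) := h.
rewrite [d * (#|T| * _)](_ : _ = #|T| * ('C(d, b) * (d * 'C(d.-1, a.-1)))).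
  by rewrite e; nia.
nia.
Qed.

End Degree.

(** * Convexity of the balanced product of binomials *)

(** Since [k.+1 * 'C(u, k.+1) = (u - k) * 'C(u, k)], the claim reduces to [u - k <= v - k]. *)
Lemma leq_bin_cross k u v : u <= v ->
  'C(u, k.+1) * 'C(v, k) <= 'C(u, k) * 'C(v, k.+1).
Proof.
move=> leuv; rewrite -(leq_pmul2l (ltn0Sn k)).
rewrite mulnA mul_bin_left mulnCA [k.+1 * 'C(v, _)]mul_bin_left.
rewrite -mulnA [in X in _ <= X]mulnCA leq_mul2r leq_sub2r ?orbT //.
Qed.

(** For positive [a], the number of copies of K_{a,a} in the balanced complete bipartite graph on
    [m] vertices. *)
Definition balanced_bin a m := 'C(m./2, a) * 'C(uphalf m, a).

(** By [leq_bin_cross], moving one vertex from the larger part to the smaller never decreases the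
    product; this is iterated until the parts are balanced. *)
Lemma leq_balanced_bin a u v : 0 < a ->
  'C(u, a) * 'C(v, a) <= balanced_bin a (u + v).
Proof.
case: a => // k _; wlog leuv : u v / u <= v => [hw|].
  by have [/hw//|/ltnW/hw] := leqP u v; rewrite mulnC addnC.
have [n] := ubnP (v - u); elim: n u v leuv => // n IHn u v leuv lt_n.
have [le1|gt1] := leqP v u.+1.
  rewrite /balanced_bin; suff [-> ->] : (u + v)./2 = u /\ uphalf (u + v) = v.
    by [].
  by split; lia.
case: v leuv lt_n gt1 => // v leuv lt_n gt1.
rewrite -addSnnS; apply: (@leq_trans ('C(u.+1, k.+1) * 'C(v, k.+1))).
  rewrite !binS mulnDr mulnDl leq_add2l leq_bin_cross // -ltnS; exact: ltnW.
by apply: IHn; lia.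
Qed.

Definition convex_seq (F : nat -> nat) := forall n, F n.+1 + F n.+1 <= F n + F n.+2.

(** Let x, y, z be the binomials of m, m + 1, m + 2 over [a]. Three consecutive values are x^2, xy,
    y^2 or xy, y^2, yz; the first case is 2xy <= x^2 + y^2, the second follows from 2y <= x + z. *)
Lemma convex_balanced_bin a : 0 < a -> convex_seq (balanced_bin a).
Proof.
case: a => // k _ n; rewrite /balanced_bin.
have [m [->|->]] : exists m, n = m.*2 \/ n = m.*2.+1.
  by exists n./2; lia.
- have [-> -> -> -> ->] : [/\ m.*2./2 = m, uphalf m.*2 = m, m.*2.+1./2 = m,
    uphalf m.*2.+1 = m.+1 & m.*2.+2./2 = m.+1] by split; lia.
  have -> : uphalf m.*2.+2 = m.+1 by lia.
  by rewrite addnn -mul2n !mulnn nat_Cauchy.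
- have [-> -> ->] : [/\ m.*2.+1./2 = m, uphalf m.*2.+1 = m.+1 &
    m.*2.+2./2 = m.+1] by split; lia.
  have [-> -> ->] : [/\ uphalf m.*2.+2 = m.+1, m.*2.+3./2 = m.+1 &
    uphalf m.*2.+3 = m.+2] by split; lia.
  have h : 'C(m.+1, k.+1) + 'C(m.+1, k.+1) <= 'C(m, k.+1) + 'C(m.+2, k.+1).
    rewrite [X in _ <= _ + X]binS addnCA leq_add2l.
    rewrite [X in X <= _]binS leq_add2l.
    exact: leq_bin2l.
  by nia.
Qed.

Section Convex.
Variable F : nat -> nat.
Hypothesis cvxF : convex_seq F.

Lemma convex_seq_shift x y k : x <= y -> F (x + k) + F y <= F x + F (y + k).
Proof.
move=> lexy.
have step u v : u <= v -> F u.+1 + F v <= F u + F v.+1.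
  move=> /subnK <-; elim: (v - u) => [|n IHn]; first by rewrite addnC.
  by have := cvxF (n + u); rewrite addSn; lia.
elim: k => [|k IHk]; first by rewrite !addn0.
by have := step (x + k) (y + k); rewrite !addnS leq_add2r lexy; lia.
Qed.

Hypothesis F0 : F 0 = 0.
Variable D : nat.
Hypothesis D_gt0 : 0 < D.

(** The total of [F] when [n] vertices are cut into blocks of size [D] and one remainder. For
    [balanced_bin a] and [D = 2 * d] this counts the copies in the graph of (ii). *)
Definition periodic_sum n := n %/ D * F D + F (n %% D).

Lemma leq_periodic_sumD n m :
  m <= D -> periodic_sum n + F m <= periodic_sum (n + m).
Proof.
move=> lemD; rewrite /periodic_sum.
move: (n %/ D) (n %% D) (divn_eq n D) (ltn_pmod n D_gt0) => q r -> lt_r.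
rewrite -[q * D + r + m]addnA divnMDl // modnMDl mulnDl -!addnA leq_add2l.
have [lt_rm|ge_rm] := ltnP (r + m) D.
  rewrite divn_small // modn_small //.
  by have := convex_seq_shift m (leq0n r); rewrite F0 !add0n addnC.
(* Here a block fills up: [r] and [m] are replaced by [r'] and [D], which have the same sum but are
   further apart, so convexity applies. *)
have [r' er'] : exists r', r + m = D + r' by exists (r + m - D); lia.
have lt_r' : r' < D by lia.
rewrite er' divnDl ?dvdnn // divnn D_gt0 divn_small // modnDl modn_small //.
have le_r'm : r' <= m by lia.
have := convex_seq_shift (D - m) le_r'm.
have -> : r' + (D - m) = r by lia.
by rewrite subnKC //; lia.
Qed.

Lemma leq_periodic_sum : {homo periodic_sum : m n / m <= n}.
Proof.
apply: homo_leq leq_trans _ => // n.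
by rewrite -addn1; apply: leq_trans (leq_periodic_sumD n D_gt0); apply: leq_addr.
Qed.

End Convex.

(** * Clusters of intersecting copies of K_{a,a} *)

(** Both intersections on the left lie in [B], and their common part lies in [A :&: C]. Hence two
    sets with large overlaps with [B] overlap each other. *)
Lemma cards_triangle (T : finType) (A B C : {set T}) :
  #|A :&: B| + #|B :&: C| <= #|B| + #|A :&: C|.
Proof.
rewrite -cardsUI leq_add //; apply/subset_leq_card/subsetP => x; rewrite !inE.
  by case/orP=> /andP[].
by case/andP=> /andP[-> _] /andP[_ ->].
Qed.

Section BalancedBicliques.
Variables (T : finType) (G : sgraph T) (a d : nat).
Hypothesis a_gt0 : 0 < a.
Hypothesis le_ad : a <= d.
Hypothesis le_7d8a : 7 * d <= 8 * a.
Hypothesis degG : forall x, #|nbhd G x| <= d.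

Local Notation P := (bipairs a a G).

(** A common vertex of the left sides has both right sides in its neighbourhood, so their union has
    at most [d] vertices. As [d < 2 * a], the right sides then meet too, and the argument applies
    with the sides exchanged. *)
Lemma bipairs_meet A B A' B' : (A, B) \in P -> (A', B') \in P ->
  A :&: A' != set0 ->
  2 * a <= d + #|A :&: A'| /\ 2 * a <= d + #|B :&: B'|.
Proof.
have main C D C' D' : (C, D) \in P -> (C', D') \in P -> C :&: C' != set0 ->
    2 * a <= d + #|D :&: D'|.
  move=> /bipairsP[_ cD j] /bipairsP[_ cD' j'] /set0Pn[x].
  rewrite inE => /andP[xC xC'].
  have : #|D :|: D'| <= #|nbhd G x|.
    by rewrite subset_leq_card // subUset (joined_nbhd j) // (joined_nbhd j').
  by move: (degG x) (cardsUI D D'); lia.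
move=> h h' m; have hB := main _ _ _ _ h h' m; split=> //.
rewrite !(bipairs_swap _ _ _ A, bipairs_swap _ _ _ A') in h h'.
by apply: main h h' _; rewrite -card_gt0; lia.
Qed.

Lemma bipairs_meet_sym A B A' B' : (A, B) \in P -> (A', B') \in P ->
  A :&: A' != set0 -> B :&: B' != set0.
Proof. by move=> h h' /(bipairs_meet h h')[_]; rewrite -card_gt0; lia. Qed.

(** By [cards_triangle] the overlap is at least [3 * a - 2 * d], which is positive because
    [7 * d <= 8 * a]. *)
Lemma bipairs_meet_trans A B A0 B0 A' B' :
  (A, B) \in P -> (A0, B0) \in P -> (A', B') \in P ->
  A :&: A0 != set0 -> A0 :&: A' != set0 -> A :&: A' != set0.
Proof.
move=> h h0 h' /(bipairs_meet h h0)[m _] /(bipairs_meet h0 h')[m' _].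
have /bipairsP[cA0 _ _] := h0.
by have := cards_triangle A A0 A'; rewrite -card_gt0; lia.
Qed.

(** Otherwise the disjoint sets [A'] and [B'] would each share [2 * a - d] vertices with [A], more
    than the [a] vertices available. *)
Lemma bipairs_meet_cross A B A' B' : (A, B) \in P -> (A', B') \in P ->
  A :&: A' != set0 -> A :&: B' = set0.
Proof.
move=> h h' /(bipairs_meet h h')[m _]; apply/eqP/negPn/negP => n.
have h'' : (B', A') \in P by rewrite bipairs_swap.
have [m' _] := bipairs_meet h h'' n.
have /bipairsP[cA _ _] := h; have /bipairsP[_ _ j'] := h'.
have A'B'0 : A' :&: B' = set0.
  apply/setP=> x; rewrite !inE; apply/negP=> /andP[xA'].
  by rewrite (negbTE (joined_notin j' xA')).
have := cards_triangle A' A B'.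
by rewrite A'B'0 cards0 setIC; lia.
Qed.

(** Multiplied by [d - 1] and divided by ['C(d, a)], this becomes
    [a * (d - a) <= (d - 1) * (2 * a - d)]. *)
Lemma bin_pred2_bound : d * 'C(d.-2, a.-1) <= (2 * a - d) * 'C(d, a).
Proof.
(* The case [a = d] covers [d = 1], where multiplying by [d.-1] would lose everything. *)
have [ed|nad] := eqVneq a d.
  rewrite -ed binn; case: (a) a_gt0 => [|[|k]] // _.
  by rewrite (bin_small (m := k.+1)) ?muln0.
have d1_gt0 : 0 < d.-1 by lia.
rewrite -(leq_pmul2l d1_gt0).
have e1 := mul_bin_diag d.-1 a.-1; have e2 := mul_bin_down d a.
rewrite prednK // in e1.
have -> : d.-1 * (d * 'C(d.-2, a.-1)) = a * (d - a) * 'C(d, a).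
  by rewrite mulnCA e1 mulnCA e2 mulnA.
rewrite mulnA leq_mul2r; apply/orP; right.
by nia.
Qed.

Section Cluster.
Variables A0 B0 : {set T}.
Hypothesis hP0 : (A0, B0) \in P.
Variable O : {set {set T} * {set T}}.
Hypothesis subO : O \subset P.
Hypothesis meetO : forall A B, (A, B) \in O -> A :&: A0 != set0.

Local Notation U := (\bigcup_(Q in O) Q.1).
Local Notation W := (\bigcup_(Q in O) Q.2).

Lemma cluster_meet A B A' B' : (A, B) \in O -> (A', B') \in O ->
  A :&: A' != set0.
Proof.
move=> h h'; apply: bipairs_meet_trans (subsetP subO _ h) hP0 (subsetP subO _ h') _ _.
  exact: meetO h.
by rewrite setIC; exact: meetO h'.
Qed.

Lemma cluster_parts_disjoint : [disjoint U & W].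
Proof.
apply/pred0P=> x /=; apply/negP=> /andP[/bigcupP[[A B] h /= xA]].
move=> /bigcupP[[A' B'] h' /= xB'].
have := bipairs_meet_cross (subsetP subO _ h) (subsetP subO _ h')
  (cluster_meet h h').
by move/setP/(_ x); rewrite !inE xA xB'.
Qed.

Lemma cluster_card_parts : #|O| <= 'C(#|U|, a) * 'C(#|W|, a).
Proof.
rewrite -!cards_draws -cardsX; apply/subset_leq_card/subsetP => -[A B] h.
have /bipairsP[cA cB _] := subsetP subO _ h.
by rewrite !inE /= cA cB eqxx !andbT (bigcup_sup (A, B)) //= (bigcup_sup (A, B)).
Qed.

(** Double counting of the edges between [U] and [B0]: a vertex of [U] has at least [2 * a - d]
    neighbours in [B0], since its right side overlaps [B0] that much, and a vertex of [B0] has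
    degree at most [d]. *)
Lemma cluster_part_bound : #|U| * (2 * a - d) <= a * d.
Proof.
have /bipairsP[_ cB0 _] := hP0.
rewrite -[X in _ <= X * d]cB0 -!sum_nat_const.
apply: (@leq_trans (\sum_(x in U) #|[set y in B0 | G x y]|)).
  apply: leq_sum => x /bigcupP[[A B] h /= xA].
  have hP := subsetP subO _ h; have /bipairsP[_ _ j] := hP.
  have [_] := bipairs_meet hP hP0 (meetO h).
  suff : #|B :&: B0| <= #|[set y in B0 | G x y]| by lia.
  apply/subset_leq_card/subsetP => y; rewrite !inE => /andP[yB ->].
  by move/joinedP: j => ->.
rewrite double_count; apply: leq_sum => y _; apply: leq_trans (degG y).
apply/subset_leq_card/subsetP => x; rewrite !inE => /andP[_].
by rewrite adj_sym.
Qed.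

(* If some right part has [d] common neighbours, these form the whole
   neighbourhood of each of its vertices and hence contain all left parts;
   otherwise every common neighbourhood loses a vertex, and the bound on
   [#|U|] makes up for the difference. *)
Lemma cluster_card : #|O| <= 'C(d, a) ^ 2.
Proof.
have [/existsP[[A B] /andP[h /= ge_d]]|] :=
    boolP [exists Q, (Q \in O) && (d <= #|common_nbhd G Q.2|)].
  have /bipairsP[_ cB _] := subsetP subO _ h.
  have cN x : x \in B -> common_nbhd G B = nbhd G x.
    move=> xB; apply/eqP; rewrite eqEcard bigcap_inf //=.
    exact: leq_trans (degG x) ge_d.
  have cD : #|common_nbhd G B| <= d.
    by apply: card_common_nbhd => //; rewrite -card_gt0 cB.
  apply: (@leq_trans (#|[set A : {set T} | A \subset common_nbhd G B & #|A| == a]|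
      * 'C(d, a))); last first.
    by rewrite cards_draws expnS expn1 leq_mul2r leq_bin2l ?orbT.
  apply: leq_card_fibers => [[A' B'] h'|A'].
    have hP' := subsetP subO _ h'; have /bipairsP[cA' _ j'] := hP'.
    have := bipairs_meet_sym (subsetP subO _ h) hP' (cluster_meet h h').
    case/set0Pn=> y; rewrite !inE /= cA' eqxx andbT => /andP[yB yB'].
    by rewrite (cN y) // (joined_nbhd _ yB') // joined_sym.
  rewrite inE => /andP[_ /eqP cA'].
  have [x xA'] : exists x, x \in A' by apply/set0Pn; rewrite -card_gt0 cA'.
  apply: (@leq_trans #|[set B : {set T} | B \subset nbhd G x & #|B| == a]|).
    apply/subset_leq_card/subsetP => B'; rewrite !inE => h'.
    have /bipairsP[_ -> j'] := subsetP subO _ h'.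
    by rewrite (joined_nbhd j') ?eqxx.
  by rewrite cards_draws leq_bin2l.
rewrite negb_exists => /forallP small.
have hcount : a * #|O| <= #|U| * ('C(d, a) * 'C(d.-2, a.-1)).
  apply: (bipairs_count_vertex degG a_gt0 subO (e := d.-1)) => A B h.
  by split; [exact: (bigcup_sup (A, B)) | have := small (A, B); rewrite h /=; lia].
(* Multiplying [hcount] by [2 * a - d] turns [#|U|] into [a * d], and [bin_pred2_bound] then absorbs
   the factor [d]. *)
have pos : 0 < a * (2 * a - d) by nia.
rewrite -(leq_pmul2l pos).
have h1 := leq_mul hcount (leqnn (2 * a - d)).
have h2 := leq_mul cluster_part_bound (leqnn ('C(d, a) * 'C(d.-2, a.-1))).
have h3 := leq_mul (leqnn (a * 'C(d, a))) bin_pred2_bound.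
rewrite -mulnn; nia.
Qed.

End Cluster.

Definition bipairs_in (X : {set T}) : {set {set T} * {set T}} :=
  [set Q in P | Q.1 :|: Q.2 \subset X].

(** Strong induction on [#|X|]: the cluster [O] of one pair is removed together with the vertices
    [U :|: W] that it covers. The factor 2 arises because the pairs are ordered. *)
Lemma card_bipairs_in X :
  #|bipairs_in X| <= 2 * periodic_sum (balanced_bin a) (2 * d) #|X|.
Proof.
have [n] := ubnP #|X|; elim: n X => // n IHn X lt_n.
have [->|/set0Pn[[A0 B0]]] := eqVneq (bipairs_in X) set0; first by rewrite cards0.
rewrite inE /= => /andP[hP0 sub0].
pose O := [set Q in bipairs_in X | Q.1 :&: A0 != set0].
pose U := \bigcup_(Q in O) Q.1; pose W := \bigcup_(Q in O) Q.2.
pose swap (Q : {set T} * {set T}) := (Q.2, Q.1).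
have subO : O \subset P by apply/subsetP=> Q; rewrite !inE -andbA => /and3P[].
have meetO A B : (A, B) \in O -> A :&: A0 != set0 by rewrite inE => /andP[].
have O0 : (A0, B0) \in O.
  have /bipairsP[cA _ _] := hP0.
  by rewrite in_set /= setIid -card_gt0 cA a_gt0 andbT in_set hP0.
have subU : U :|: W \subset X.
  rewrite subUset; apply/andP; split; apply/bigcupsP => -[A B];
    by rewrite inE => /andP[]; rewrite inE => /andP[_ /=]; rewrite subUset => /andP[].
have memO A B A' B' : (A, B) \in bipairs_in X -> (A', B') \in O ->
    A :&: A' != set0 -> (A, B) \in O.
  move=> h h' m; rewrite inE h /=; move: h; rewrite inE => /andP[hP _].
  exact: bipairs_meet_trans hP (subsetP subO _ h') hP0 m (meetO _ _ h').
have swapX A B : (A, B) \in bipairs_in X -> (B, A) \in bipairs_in X.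
  by rewrite !inE /= setUC joined_sym andbCA.
have memO2 A B A' B' : (A, B) \in bipairs_in X -> (A', B') \in O ->
    B :&: B' != set0 -> (A, B) \in O.
  move=> h h' m; apply: (memO _ _ _ _ h h').
  move: h; rewrite inE => /andP[]; rewrite bipairs_swap => hP _.
  apply: bipairs_meet_sym hP _ m.
  by rewrite bipairs_swap (subsetP subO).
(* A pair that touches [U :|: W] belongs to the cluster, possibly after exchange of its sides. *)
have cover : bipairs_in X \subset
    (O :|: swap @: O) :|: bipairs_in (X :\: (U :|: W)).
  apply/subsetP=> -[A B] h; rewrite [in X in is_true X]inE.
  have [//|/=] := boolP ((A, B) \in O :|: swap @: O).
  rewrite in_setU negb_or => /andP[nO nO'].
  have {}nO' : (B, A) \notin O.
    by apply: contra nO' => hBA; apply/imsetP; exists (B, A).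
  have h' := swapX _ _ h.
  move: (h); rewrite inE /= => /andP[hP sub].
  rewrite inE hP /= subsetD sub /= disjoint_sym.
  apply/pred0P=> x /=; apply/negP.
  have mem (C D : {set T}) : x \in C -> x \in D -> C :&: D != set0.
    by move=> xC xD; apply/set0Pn; exists x; rewrite inE xC.
  rewrite !inE => /andP[/orP[] /bigcupP[[A' B'] hO /= xI] /orP[] xI'].
  + by case/negP: nO; apply: memO hO _ => //; apply: mem.
  + by case/negP: nO'; apply: memO hO _ => //; apply: mem.
  + by case/negP: nO'; apply: memO2 hO _ => //; apply: mem.
  + by case/negP: nO; apply: memO2 hO _ => //; apply: mem.
have cvx := convex_balanced_bin a_gt0.
have F0 : balanced_bin a 0 = 0 by rewrite /balanced_bin bin_small.
have D_gt0 : 0 < 2 * d by lia.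
have cX : #|X| = #|X :\: (U :|: W)| + #|U :|: W|.
  by rewrite cardsD (setIidPr subU) subnK // subset_leq_card.
have cUW : #|U :|: W| = #|U| + #|W|.
  by apply/eqP; rewrite (leq_card_setU U W).2; apply: cluster_parts_disjoint hP0 _ subO meetO.
have UW_gt0 : 0 < #|U :|: W|.
  have /bipairsP[cA _ _] := hP0.
  have : #|A0| <= #|U| by rewrite subset_leq_card // (bigcup_sup (A0, B0)).
  lia.
have IH := IHn (X :\: (U :|: W)) ltac:(lia).
(* A cluster on more than [2 * d] vertices still has at most ['C(d, a) ^ 2] pairs, so it counts as
   one full block. *)
have cO : #|O| <= balanced_bin a (minn #|U :|: W| (2 * d)).
  have [le2d|gt2d] := leqP #|U :|: W| (2 * d).
    rewrite cUW; apply: leq_trans (leq_balanced_bin _ _ a_gt0).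
    exact: cluster_card_parts subO.
  apply: leq_trans (cluster_card hP0 subO meetO) _.
  by rewrite /balanced_bin mul2n doubleK uphalf_double mulnn.
apply: leq_trans (subset_leq_card cover) _.
apply: leq_trans (leq_card_setU _ _) _.
have : #|O :|: swap @: O| <= 2 * #|O|.
  apply: leq_trans (leq_card_setU _ _) _.
  by rewrite mul2n -addnn leq_add2l leq_imset_card.
have := leq_periodic_sumD cvx F0 D_gt0 #|X :\: (U :|: W)|
  (geq_minr #|U :|: W| (2 * d)).
have : periodic_sum (balanced_bin a) (2 * d)
    (#|X :\: (U :|: W)| + minn #|U :|: W| (2 * d))
  <= periodic_sum (balanced_bin a) (2 * d) #|X|.
  by apply: leq_periodic_sum => //; rewrite cX leq_add2l geq_minl.
lia.
Qed.

Lemma leq_card_balanced_bipairs :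
  #|P| <= 2 * periodic_sum (balanced_bin a) (2 * d) #|T|.
Proof.
rewrite -cardsT; apply: leq_trans (card_bipairs_in _).
by apply/subset_leq_card/subsetP => Q hQ; rewrite inE hQ subsetT.
Qed.

End BalancedBicliques.

(** * Disjoint unions of bicliques *)

Lemma cards_disjointU (T : finType) (A B : {set T}) :
  A :&: B = set0 -> #|A| + #|B| = #|A :|: B|.
Proof. by rewrite -cardsUI => ->; rewrite cards0 addn0. Qed.

(** The two terms come from the two orientations; these give distinct pairs because the first set is
    nonempty. *)
Lemma leq_card_bipairs_biclique a b m1 m2 : 0 < a ->
  'C(m1, a) * 'C(m2, b) + 'C(m2, a) * 'C(m1, b)
    <= #|bipairs a b (biclique m1 m2)|.
Proof.
move=> a_gt0; pose draws m k := [set A : {set 'I_m} | #|A| == k].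
have cd m k : #|draws m k| = 'C(m, k) by rewrite card_draws card_ord.
pose f (P : {set 'I_m1} * {set 'I_m2}) : {set 'I_m1 + 'I_m2} * {set 'I_m1 + 'I_m2} :=
  (inl @: P.1, inr @: P.2).
pose g (P : {set 'I_m2} * {set 'I_m1}) : {set 'I_m1 + 'I_m2} * {set 'I_m1 + 'I_m2} :=
  (inr @: P.1, inl @: P.2).
have injl : injective (@inl 'I_m1 'I_m2) by move=> ? ? [].
have injr : injective (@inr 'I_m1 'I_m2) by move=> ? ? [].
have injf : injective f.
  by move=> [A B] [A' B'] [/(imset_inj injl)-> /(imset_inj injr)->].
have injg : injective g.
  by move=> [A B] [A' B'] [/(imset_inj injr)-> /(imset_inj injl)->].
rewrite -!cd -!cardsX -(card_imset _ injf) -(card_imset _ injg).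
rewrite cards_disjointU //.
  apply/subset_leq_card/subsetP => Q /setUP[] /imsetP[[A B]] /setXP[];
    rewrite !in_set => /eqP cA /eqP cB ->;
    rewrite !card_imset // cA cB !eqxx /=;
    by apply/joinedP=> _ _ /imsetP[x _ ->] /imsetP[y _ ->]; rewrite graph_ofE.
apply/setP=> Q; rewrite in_set0 in_setI; apply/negP=> /andP[].
case/imsetP=> -[A B]; rewrite !inE /= => /andP[/eqP cA _] ->.
case/imsetP=> -[A' B'] _ [e _].
have [x xA] : exists x, x \in A by apply/set0Pn; rewrite -card_gt0 cA.
have : inl x \in [set inr y | y in A'] by rewrite -e imset_f.
by case/imsetP.
Qed.

Lemma leq_card_bipairs_gunion a b (S T : finType) (G : sgraph S) (H : sgraph T) :
  0 < a -> #|bipairs a b G| + #|bipairs a b H| <= #|bipairs a b (gunion G H)|.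
Proof.
move=> a_gt0.
have injl : injective (@inl S T) by move=> ? ? [].
have injr : injective (@inr S T) by move=> ? ? [].
rewrite -(card_imset _ (imset_pair_inj injl)).
rewrite -(card_imset _ (imset_pair_inj injr)).
rewrite cards_disjointU //.
  apply/subset_leq_card; rewrite subUset.
  by apply/andP; split; apply: imset_pair_bipairs => // x y h; rewrite graph_ofE.
apply/setP=> Q; rewrite in_set0 in_setI; apply/negP=> /andP[].
case/imsetP=> -[A B] /bipairsP[cA _ _] -> /imsetP[[A' B'] _ [e _]].
have [x xA] : exists x, x \in A by apply/set0Pn; rewrite -card_gt0 cA.
have : inl x \in [set inr y | y in A'] by rewrite -e imset_f.
by case/imsetP.
Qed.

Lemma leq_card_bipairs_gmult a b k (T : finType) (G : sgraph T) :
  0 < a -> k * #|bipairs a b G| <= #|bipairs a b (gmult k G)|.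
Proof.
move=> a_gt0; rewrite -[k in k * _]card_ord -cardsT -cardsX.
pose f (p : 'I_k * ({set T} * {set T})) := imset_pair (pair p.1) p.2.
have injp (i : 'I_k) : injective (@pair _ T i) by move=> ? ? [].
rewrite -(@card_in_imset _ _ f) => [|[i [A B]] [j [A' B']]]; last first.
  rewrite !inE /= => /and3P[/eqP cA _ _] _ /[dup] [[e _]].
  have [x xA] : exists x, x \in A by apply/set0Pn; rewrite -card_gt0 cA.
  have : (i, x) \in [set (j, y) | y in A'] by rewrite -e imset_f.
  by case/imsetP=> y _ [-> _] /(imset_pair_inj (injp _)) /= ->.
apply/subset_leq_card/subsetP => _ /imsetP[[i Q] + ->].
rewrite in_setX in_setT /= => hQ.
apply: (subsetP (@imset_pair_bipairs _ _ _ (injp i) a b G _ _)).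
  by move=> x y h; rewrite graph_ofE /gmult_rel /= eqxx.
exact: imset_f.
Qed.

Lemma card_nbhd_biclique m1 m2 d (x : 'I_m1 + 'I_m2) : m1 <= d -> m2 <= d ->
  #|nbhd (biclique m1 m2) x| <= d.
Proof.
move=> le1 le2; case: x => i.
  apply: (@leq_trans #|[set (inr j : 'I_m1 + 'I_m2) | j : 'I_m2]|).
    apply/subset_leq_card/subsetP => -[j|j]; rewrite inE graph_ofE //= => _.
    exact: imset_f.
  by rewrite (leq_trans (leq_imset_card _ _)) // card_ord.
apply: (@leq_trans #|[set (inl j : 'I_m1 + 'I_m2) | j : 'I_m1]|).
  apply/subset_leq_card/subsetP => -[j|j]; rewrite inE graph_ofE //= => _.
  exact: imset_f.
by rewrite (leq_trans (leq_imset_card _ _)) // card_ord.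
Qed.

Lemma card_nbhd_gunion (S T : finType) (G : sgraph S) (H : sgraph T) d :
  (forall x, #|nbhd G x| <= d) -> (forall x, #|nbhd H x| <= d) ->
  forall x, #|nbhd (gunion G H) x| <= d.
Proof.
move=> dG dH [x|x]; [move: (dG x)|move: (dH x)]; apply: leq_trans.
  apply: (@leq_trans #|[set (inl y : S + T) | y in nbhd G x]|); last exact: leq_imset_card.
  apply/subset_leq_card/subsetP => -[y|y]; rewrite inE graph_ofE //= => h.
  by rewrite imset_f // inE.
apply: (@leq_trans #|[set (inr y : S + T) | y in nbhd H x]|); last exact: leq_imset_card.
apply/subset_leq_card/subsetP => -[y|y]; rewrite inE graph_ofE //= => h.
by rewrite imset_f // inE.
Qed.

Lemma card_nbhd_gmult k (T : finType) (G : sgraph T) d :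
  (forall x, #|nbhd G x| <= d) -> forall x, #|nbhd (gmult k G) x| <= d.
Proof.
move=> dG [i x]; apply: leq_trans (dG x).
apply: (@leq_trans #|pair i @: nbhd G x|); last exact: leq_imset_card.
apply/subset_leq_card/subsetP => -[j y]; rewrite inE graph_ofE /gmult_rel /=.
by case/andP=> /eqP <- h; rewrite imset_f // inE.
Qed.

(** * Extremal numbers for a forbidden star *)

Lemma leq_extremal_star n a b d m :
  (forall G : sgraph 'I_n, (forall x, #|nbhd G x| <= d) ->
     ncopies (biclique a b) G <= m) ->
  extremal n (biclique a b) (biclique 1 d.+1) <= m.
Proof. by move=> hm; apply/bigmax_leqP => G /free_starP; apply: hm. Qed.

Section Star.
Variables (a b d : nat).
Hypotheses (a_gt0 : 0 < a) (b_gt0 : 0 < b) (d_gt0 : 0 < d).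

(** The factor [(a == b).+1] converts copies into ordered pairs. *)
Lemma extremal_star_bound n :
  (a == b).+1 * d * extremal n (biclique a b) (biclique 1 d.+1)
    <= n * ('C(d, a) * 'C(d, b)).
Proof.
have c_gt0 : 0 < (a == b).+1 * d by lia.
rewrite mulnC -leq_divRL //; apply: leq_extremal_star => G dG.
rewrite leq_divRL //; have := leq_card_bipairs dG a_gt0 b_gt0.
by rewrite card_bipairs // card_ord mulnA [d * _]mulnC [_ * ncopies _ _]mulnC.
Qed.

Lemma extremal_star_dvdn n : 2 * d %| n ->
  extremal n (biclique a b) (biclique 1 d.+1)
  = ncopies (biclique a b) (gmult (n %/ (2 * d)) (biclique d d)).
Proof.
move=> /divnK; set q := n %/ _ => en; apply/eqP; rewrite eqn_leq.
apply/andP; split; last first.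
  apply: leq_extremal => //.
    by rewrite card_prod card_sum !card_ord addnn -mul2n en.
  by apply/free_starP; apply: card_nbhd_gmult => x; apply: card_nbhd_biclique.
have c_gt0 : 0 < (a == b).+1 * d by lia.
rewrite -(leq_pmul2l c_gt0); apply: leq_trans (extremal_star_bound n) _.
rewrite [_ * d]mulnC -mulnA -card_bipairs //.
(* Each [biclique d d] contributes ['C(d, a) * 'C(d, b)] pairs in each orientation, so [q] of them
   attain the bound for [n = q * (2 * d)]. *)
have := leq_card_bipairs_gmult b q (biclique d d) a_gt0.
have := leq_mul (leqnn q) (leq_card_bipairs_biclique b d d a_gt0).
by rewrite -en; nia.
Qed.

End Star.

(** This weakens [extremal_star_bound] to the form of (i): the left side equals
    [d * 'C(d.-1, a.-1)]. *)
Lemma bin_pred_bound a d : 0 < a -> a * 'C(d, a) <= d * 'C(d, a - 1).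
Proof.
move=> a_gt0; have := mul_bin_diag d a.-1; rewrite prednK // => <-.
by rewrite subn1 leq_mul2l leq_bin2l ?orbT // leq_pred.
Qed.

Lemma extremal_star_lt a b d n : 0 < a -> a < b -> 0 < d ->
  (a + b) * extremal n (biclique a b) (biclique 1 d.+1)
    <= n * ('C(d, a) * 'C(d, b - 1) + 'C(d, b) * 'C(d, a - 1)).
Proof.
move=> a_gt0 lt_ab d_gt0; have b_gt0 : 0 < b by lia.
have := extremal_star_bound a_gt0 b_gt0 d_gt0 n; rewrite ltn_eqF // mul1n => h.
have ha := bin_pred_bound d a_gt0; have hb := bin_pred_bound d b_gt0.
rewrite -(leq_pmul2l d_gt0).
have h1 := leq_mul (leqnn (a + b)) h.
have h2 := leq_mul (leqnn (n * 'C(d, a))) hb.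
have h3 := leq_mul (leqnn (n * 'C(d, b))) ha.
by nia.
Qed.

Lemma extremal_star_eq a d n : 0 < a -> 0 < d ->
  2 * a * extremal n (biclique a a) (biclique 1 d.+1)
    <= n * ('C(d, a) * 'C(d, a - 1)).
Proof.
move=> a_gt0 d_gt0.
have := extremal_star_bound a_gt0 a_gt0 d_gt0 n; rewrite eqxx => h.
have ha := bin_pred_bound d a_gt0.
rewrite -(leq_pmul2l d_gt0).
have h1 := leq_mul (leqnn a) h.
have h3 := leq_mul (leqnn (n * 'C(d, a))) ha.
by nia.
Qed.

Lemma extremal_star_balanced a d n : 0 < a -> a <= d -> 7 * d <= 8 * a ->
  extremal n (biclique a a) (biclique 1 d.+1)
  = ncopies (biclique a a)
      (gunion (gmult (n %/ (2 * d)) (biclique d d))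
              (biclique (n %% (2 * d))./2 (uphalf (n %% (2 * d))))).
Proof.
move=> a_gt0 le_ad le_7d8a; set q := n %/ _; set p := n %% _.
have lt_p : p < 2 * d by rewrite ltn_pmod //; lia.
have en : n = q * (2 * d) + p := divn_eq n (2 * d).
apply/eqP; rewrite eqn_leq; apply/andP; split; last first.
  apply: leq_extremal => //.
    by rewrite !(card_sum, card_prod) !card_ord; lia.
  apply/free_starP; apply: card_nbhd_gunion => [|x].
    by apply: card_nbhd_gmult => x; apply: card_nbhd_biclique.
  by apply: card_nbhd_biclique; lia.
(* Doubling both sides turns copies of K_{a,a} into ordered pairs. *)
apply: leq_extremal_star => G dG; rewrite -(leq_pmul2l (ltn0Sn 1)).
have := leq_card_balanced_bipairs a_gt0 le_ad le_7d8a dG.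
rewrite !(card_bipairs, card_ord) // eqxx => /leq_trans; apply.
have := card_bipairs (gunion (gmult q (biclique d d))
  (biclique p./2 (uphalf p))) a_gt0 a_gt0.
rewrite eqxx => <-.
apply: leq_trans (leq_card_bipairs_gunion _ _ _ a_gt0).
have h1 := leq_card_bipairs_gmult a q (biclique d d) a_gt0.
have h2 := leq_mul (leqnn q) (leq_card_bipairs_biclique a d d a_gt0).
have h3 := leq_card_bipairs_biclique a p./2 (uphalf p) a_gt0.
apply: leq_trans (leq_add (leq_trans h2 h1) h3).
rewrite /periodic_sum -/q -/p /balanced_bin [2 * d]mul2n doubleK uphalf_double.
by nia.
Qed.

(** * A K_{2,b+1}-free graph with many copies of K_{b,b} *)

Import GRing.Theory.

Lemma exists_subset_card (T : finType) (D : {set T}) m :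
  m <= #|D| -> exists2 C : {set T}, C \subset D & #|C| = m.
Proof.
move=> /card_geqP[s [us ss sub]]; exists [set x in s]; last first.
  by rewrite cardsE (card_uniqP us).
by apply/subsetP=> x; rewrite inE => /sub.
Qed.

Section Tiling.
Local Open Scope ring_scope.
Variable V : finZmodType.

(** A packing of [V] by disjoint translates of [C]; they need not cover [V]. *)
Definition tiles (C S : {set V}) :=
  forall y y' c c', y \in S -> y' \in S -> c \in C -> c' \in C ->
  y + c = y' + c' -> y = y'.

(** For a maximal [S], every element has the form [y + c - c'], since otherwise it could be added to
    [S]. *)
Lemma exists_large_tiles (C : {set V}) : C != set0 ->
  exists2 S : {set V}, tiles C S & (#|V| <= #|S| * #|C| ^ 2)%N.
Proof.
move=> /set0Pn[c0 c0C].
pose P (S : {set V}) := [forall y in S, forall y' in S, forall c in C,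
  forall c' in C, (y + c == y' + c') ==> (y == y')].
have PP S : reflect (tiles C S) (P S).
  apply: (iffP forall_inP) => [h y y' c c' yS y'S cC c'C /eqP e|h y yS].
    have /forall_inP/(_ _ y'S)/forall_inP/(_ _ cC) := h y yS.
    by move=> /forall_inP/(_ _ c'C)/implyP/(_ e)/eqP.
  apply/forall_inP=> y' y'S; apply/forall_inP=> c cC.
  apply/forall_inP=> c' c'C; apply/implyP=> /eqP e.
  by apply/eqP/(h _ _ c c').
have P0 : P set0 by apply/PP => y ?; rewrite inE.
have [S /maxsetP[/PP tS maxS] _] := maxset_exists P0.
exists S => //.
have cover u : exists y c c', [/\ y \in S, c \in C, c' \in C & u = y + c - c'].
  have [uS|nuS] := boolP (u \in S); first by exists u, c0, c0; rewrite addrK.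
  have : ~~ P (u |: S).
    apply: contra nuS => PuS; rewrite -(maxS _ PuS) ?setU11 //.
    exact: subsetUr.
  case/forall_inPn=> y yU /forall_inPn[y' y'U] /forall_inPn[c cC].
  case/forall_inPn=> c' c'C; rewrite negb_imply => /andP[/eqP e ne].
  move: yU y'U; rewrite !in_setU1 => /orP[/eqP ey|yS] /orP[/eqP ey'|y'S].
  - by rewrite ey ey' eqxx in ne.
  - by exists y', c', c; rewrite -e ey addrK.
  - by exists y, c, c'; rewrite e ey' addrK.
  - by rewrite (tS _ _ _ _ yS y'S cC c'C e) eqxx in ne.
rewrite -cardsT expnS expn1 -!cardsX.
pose g (p : V * (V * V)) := p.1 + p.2.1 - p.2.2.
apply: leq_trans (leq_imset_card g _); apply/subset_leq_card/subsetP => u _.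
have [y [c [c' [yS cC c'C ->]]]] := cover u.
by apply/imsetP; exists (y, (c, c')) => //; rewrite !inE yS cC.
Qed.

(** Inside a tile, [f] reads off the offset, which is unique by [tiles]; elsewhere it takes a
    default value in [C]. *)
Lemma tiles_retraction (C S : {set V}) : C != set0 -> tiles C S ->
  exists2 f : V -> V, forall u, f u \in C &
    forall y c, y \in S -> c \in C -> f (y + c) = c.
Proof.
move=> /set0Pn[c0 c0C] tS.
exists (fun u => odflt c0 [pick c in C | u - c \in S]) => [u|y c yS cC].
  by case: pickP => //= c /andP[].
case: pickP => [c' /= /andP[c'C c'S]|/(_ c)]; last by rewrite addrK cC yS.
have e : y + c = (y + c - c') + c' by rewrite subrK.
have := tS _ _ _ _ yS c'S cC c'C e => {}e.
by apply: (addrI y); rewrite {1}e subrK.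
Qed.

End Tiling.

Section NormGraph.
Local Open Scope ring_scope.
Variables (F : finFieldType) (f : F -> F).

(** For [f = 0] this is the incidence of points with non-vertical lines in the affine plane, a
    K_{2,2}-free graph. The product of values of [f] is the twist that creates larger bicliques. *)
Definition twisted_incidence (p q : F * F) : bool :=
  p.2 + q.2 == p.1 * q.1 - f p.1 * f q.1.

Definition twisted_rel : rel (F * F + F * F) := fun u v =>
  match u, v with
  | inl p, inr q | inr p, inl q => twisted_incidence p q
  | _, _ => false
  end.

Lemma twisted_incidence_sym p q : twisted_incidence p q = twisted_incidence q p.
Proof.
by rewrite /twisted_incidence addrC [q.1 * _]mulrC [f q.1 * _]mulrC.
Qed.

Lemma twisted_irr : irreflexive twisted_rel. Proof. by case. Qed.

Lemma twisted_sym : symmetric twisted_rel.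
Proof. by case=> p [] q //=; rewrite twisted_incidence_sym. Qed.

Definition twisted_graph := graph_of twisted_irr twisted_sym.

(** When [f] agrees on the first coordinates of [q] and [q'], the alternating sum of the four
    equations loses all terms in [f] and leaves [(y1 - y2) * (x - x') = 0]. *)
Lemma twisted_incidence_inj p1 p2 q q' : p1 != p2 -> f q.1 = f q'.1 ->
  twisted_incidence p1 q -> twisted_incidence p2 q ->
  twisted_incidence p1 q' -> twisted_incidence p2 q' -> q = q'.
Proof.
case: p1 p2 q q' => y1 w1 [y2 w2] [x v] [x' v'] /= ne e.
rewrite /twisted_incidence /= e => /eqP e1 /eqP e2 /eqP e3 /eqP e4.
have /eqP : (y1 - y2) * (x - x') = 0.
  transitivity ((w1 + v - (w2 + v)) - (w1 + v' - (w2 + v'))); last by ring.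
  by rewrite e1 e2 e3 e4; ring.
rewrite mulf_eq0 !subr_eq0 => /orP[]/eqP exy.
  move: ne e1 e2; rewrite exy => ne <- /addIr ew.
  by rewrite ew eqxx in ne.
subst x'; congr (_, _); apply: (@addrI _ w1).
by rewrite e1 e3.
Qed.

(** The value of [f] at the first coordinate is injective on common neighbours; vertices on opposite
    sides have none. *)
Lemma card_common_twisted (C : {set F}) u1 u2 : (forall x, f x \in C) ->
  u1 != u2 -> (#|nbhd twisted_graph u1 :&: nbhd twisted_graph u2| <= #|C|)%N.
Proof.
move=> fC ne.
pose key (u : F * F + F * F) := f (match u with inl p | inr p => p end).1.
rewrite -(@card_in_imset _ _ key) => [|u v].
  by apply/subset_leq_card/subsetP => _ /imsetP[u _ ->]; apply: fC.
rewrite !inE !graph_ofE => /andP[h1 h2] /andP[h1' h2'] e.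
case: u1 u2 u v ne e h1 h2 h1' h2' => p1 [] p2 // [] q // [] q' //= ne e h1 h2 h1' h2';
  congr (_ _); apply: (twisted_incidence_inj (p1 := p1) (p2 := p2)) => //;
  by apply: contra ne => /eqP->.
Qed.

Lemma free_twisted_graph (C : {set F}) s t : (forall x, f x \in C) ->
  (2 <= s)%N -> (#|C| < t)%N -> free_of (biclique s t) twisted_graph.
Proof.
move=> fC s_ge2 lt_Ct; rewrite free_bicliqueE; apply/set0Pn => -[[A B]].
case/bipairsP=> cA cB j; move: s_ge2; rewrite -cA => /card_gt1P[u1 [u2 []]].
move=> u1A u2A /(card_common_twisted fC); rewrite leqNgt => /negP; apply.
apply: leq_trans lt_Ct _; rewrite -cB; apply/subset_leq_card.
by rewrite subsetI !(joined_nbhd j).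
Qed.

Lemma card_twisted_bipairs (C S : {set F}) a :
  (0 < a)%N -> (a <= #|C|)%N ->
  (forall y c, y \in S -> c \in C -> f (y + c) = c) ->
  (#|S| * (#|S| * #|F|) <= #|bipairs a #|C| twisted_graph|)%N.
Proof.
move=> a_gt0 leaC fS; rewrite -cardsT -!cardsX.
(* The left side uses only [a] of the offsets, the right side uses all of [C]. *)
have [Ca subCa cCa] := exists_subset_card leaC.
have [c0 c0Ca] : exists c, c \in Ca by apply/set0Pn; rewrite -card_gt0 cCa.
have c0C := subsetP subCa _ c0Ca.
pose left (y x z c : F) : F * F + F * F := inl (y + c, z + x * c).
pose right (y x z c : F) : F * F + F * F := inr (x + c, x * y + y * c - z).
have left_inj y x z : injective (left y x z) by move=> c c' [/addrI].
have right_inj y x z : injective (right y x z) by move=> c c' [/addrI].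
pose g (p : F * (F * F)) :=
  (left p.1 p.2.1 p.2.2 @: Ca, right p.1 p.2.1 p.2.2 @: C).
rewrite -(@card_in_imset _ _ g) => [|[y [x z]] [y' [x' z']]].
  apply/subset_leq_card/subsetP => _ /imsetP[[y [x z]] + ->].
  rewrite !inE /= => /and3P[yS xS _]; rewrite !card_imset // cCa !eqxx /=.
  apply/joinedP => _ _ /imsetP[c cCa' ->] /imsetP[c' c'C ->].
  rewrite graph_ofE /= /twisted_incidence /= (fS x c' xS c'C).
  rewrite (fS y c yS (subsetP subCa _ cCa')).
  by apply/eqP; ring.
rewrite !inE /= => /and3P[yS xS _] /and3P[y'S x'S _] [eA eB].
(* The vertex of offset [c0] reappears with some offset in the other copy. Applying [f] shows that
   this offset is again [c0], so the parameters agree. *)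
have [c cC [ey ez]] : exists2 c, c \in Ca &
    y + c0 = y' + c /\ z + x * c0 = z' + x' * c.
  have : left y x z c0 \in left y' x' z' @: Ca by rewrite -eA imset_f.
  by case/imsetP=> c cC [-> ->]; exists c.
have [c' c'C ex] : exists2 c, c \in C & x + c0 = x' + c.
  have : right y x z c0 \in right y' x' z' @: C by rewrite -eB imset_f.
  by case/imsetP=> c' cC' [-> _]; exists c'.
have ec : c = c0 by rewrite -(fS y c0 yS c0C) ey fS // (subsetP subCa).
have ec' : c' = c0 by rewrite -(fS x c0 xS c0C) ex fS.
move: ey ez ex; rewrite ec ec' => /addIr-> + /addIr ex.
by rewrite ex => /addIr->.
Qed.

End NormGraph.

(** The squared form expresses a bound of order n^(3/2) in natural numbers. *)
Lemma extremal_lower_bound a b s t n :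
  0 < a -> a <= b -> 2 <= s -> b < t -> 2 * 4 ^ b.+1 <= n ->
  n ^ 3 <= (64 * b ^ 4 * extremal n (biclique a b) (biclique s t)) ^ 2.
Proof.
move=> a_gt0 le_ab s_ge2 lt_bt len.
(* With [q = 2 ^ k] this choice gives [2 * q ^ 2 <= n < 8 * q ^ 2]. *)
pose k := trunc_log 4 (n %/ 2).
have [lek ltk] : 4 ^ k <= n %/ 2 /\ n %/ 2 < 4 ^ k.+1.
  apply/andP; apply: trunc_log_bounds => //.
  by rewrite divn_gt0 //; apply: leq_trans len; have := expn_gt0 4 b.+1; lia.
(* Then [q = 2 ^ k > k > b], so the field contains a set [C] of [b] elements. *)
have lt_bk : b.+1 <= k by apply: trunc_log_max => //; rewrite leq_divRL // mulnC.
have k_gt0 : 0 < k by lia.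
have [F _ cF] := pPrimePowerField (isT : prime 2) k_gt0.
set q := #|F| in cF; have q4 : 4 ^ k = q ^ 2 by rewrite cF -expnM mulnC expnM.
have le_bq : b <= #|[set: F]|.
  by rewrite cardsT -/q cF; have := ltn_expl k (isT : 1 < 2); lia.
have [C _ cC] := exists_subset_card le_bq.
have C0 : C != set0 by rewrite -card_gt0 cC; lia.
have [S tS leS] := exists_large_tiles C0.
have [f fC fS] := tiles_retraction C0 tS.
have leaC : a <= #|C| by rewrite cC.
have := card_twisted_bipairs a_gt0 leaC fS.
have b_gt0 : 0 < b by lia.
rewrite cC card_bipairs // -/q => count.
have := @leq_extremal n a b s t _ (twisted_graph f) a_gt0 b_gt0 (ltnW s_ge2).
rewrite (free_twisted_graph fC) ?cC // card_sum card_prod -/q.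
have le2q : q * q + q * q <= n by move: lek; rewrite q4 -mulnn leq_divRL //; lia.
move=> /(_ (leq_ltn_trans (leq0n _) lt_bt) le2q isT).
move: (ncopies _ _) (extremal _ _ _) count => N E count leNE.
have {}leS : q <= #|S| * b ^ 2 by rewrite -cC.
have c2 : (a == b).+1 * N <= 2 * E by rewrite leq_mul // ltnS leq_b1.
have h : q ^ 3 <= 2 * E * b ^ 4.
  have -> : q ^ 3 = q * q * q by rewrite !expnS expn0 muln1 mulnA.
  apply: leq_trans (leq_mul (leq_mul leS leS) (leqnn q)) _.
  apply: (@leq_trans (#|S| * (#|S| * q) * b ^ 4)); last first.
    by rewrite leq_mul2r (leq_trans count c2) orbT.
  by apply: eq_leq; ring.
have ltn8 : n <= 8 * q ^ 2.
  move: ltk; rewrite expnS q4 ltn_divLR //; lia.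
apply: (@leq_trans ((8 * q ^ 2) ^ 3)); first by rewrite leq_exp2r.
have -> : (8 * q ^ 2) ^ 3 = 512 * (q ^ 3) ^ 2 by ring.
apply: leq_trans (leq_mul (leqnn 512) (_ : _ <= (2 * E * b ^ 4) ^ 2)) _.
  by rewrite leq_exp2r.
(* It remains to compare 512 * 4 = 2048 with 64^2 = 4096. *)
have -> : (64 * b ^ 4 * E) ^ 2 = 4096 * (b ^ 4 * E) ^ 2 by ring.
have -> : (2 * E * b ^ 4) ^ 2 = 4 * (b ^ 4 * E) ^ 2 by ring.
by rewrite mulnA leq_mul2r orbT.
Qed.

(* The bounds over the real numbers *)
From mathcomp Require Import all_classical all_reals all_analysis.
Import Order.TTheory GRing.Theory Num.Theory.
Import numFieldNormedType.Exports.
Local Open Scope classical_set_scope.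
Local Open Scope ring_scope.

Theorem theorem1p6 (R : realType) (a b t : nat)
    (a_gt0 : (0 < a)%N) (le_ab : (a <= b)%N) (t_gt0 : (0 < t)%N) :
  (* (i) *)
  [/\ (a < b)%N -> (b < t)%N -> forall n : nat,
        (extremal n (biclique a b) (biclique 1 t))%:R
        <= n%:R / (a + b)%:R
           * ('C(t - 1, a) * 'C(t - 1, b - 1)
              + 'C(t - 1, b) * 'C(t - 1, a - 1))%:R :> R,
      (a < t)%N -> forall n : nat,
        (extremal n (biclique a a) (biclique 1 t))%:R
        <= n%:R / (2 * a)%:R * ('C(t - 1, a) * 'C(t - 1, a - 1))%:R :> R
    & (b < t)%N -> forall n : nat, (2 * t - 2 %| n)%N ->
        extremal n (biclique a b) (biclique 1 t)
        = ncopies (biclique a b)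
            (gmult (n %/ (2 * t - 2)) (biclique (t - 1) (t - 1)))]
  (* (ii) *)
  /\ ((a < t)%N -> t%:R <= 8%:R * a%:R / 7%:R + 1 :> R ->
      forall n : nat,
        let q := (n %/ (2 * t - 2))%N in
        let p := (n - (2 * t - 2) * q)%N in
        extremal n (biclique a a) (biclique 1 t)
        = ncopies (biclique a a)
            (gunion (gmult q (biclique (t - 1) (t - 1)))
                    (biclique p./2 (uphalf p))))
  (* (iii) *)
  /\ (forall s : nat, (2 <= s)%N -> (s < a)%N -> (b < t)%N ->
      exists2 eps : nat -> R, eps @ \oo --> (0 : R) &
        (fun n : nat =>
           (extremal n (biclique a b) (biclique s t))%:R : R^o)
        \is 'Omega_\oo (fun n : nat => n%:R `^ (3%:R / 2%:R - eps n) : R^o)).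
Proof.
have b_gt0 : (0 < b)%N := leq_trans a_gt0 le_ab.
(* From here [d = t - 1] is the degree bound for graphs free of K_{1,t}. *)
case: t t_gt0 => // d _; have -> : (d.+1 - 1 = d)%N by rewrite subn1.
have -> : (2 * d.+1 - 2 = 2 * d)%N by rewrite mulnS addKn.
have natr_bound (n E m c : nat) : (0 < c)%N -> (c * E <= n * m)%N ->
    E%:R <= n%:R / c%:R * m%:R :> R.
  move=> c_gt0 le_cE; rewrite mulrAC ler_pdivlMr ?ltr0n // mulrC.
  by rewrite -!natrM ler_nat.
split; [|split].
- split=> [lt_ab lt_bd n|lt_ad n|lt_bd n dvd_n].
  + apply: natr_bound; first by rewrite addn_gt0 a_gt0.
    by apply: extremal_star_lt; rewrite // (leq_trans b_gt0).
  + apply: natr_bound; first by rewrite muln_gt0.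
    by apply: extremal_star_eq; rewrite // (leq_trans a_gt0).
  + by apply: extremal_star_dvdn; rewrite // (leq_trans b_gt0).
- move=> lt_ad le_d n; lazy zeta.
  have -> : (n - 2 * d * (n %/ (2 * d)) = n %% (2 * d))%N.
    by rewrite {1}(divn_eq n (2 * d)) mulnC addKn.
  apply: extremal_star_balanced => //.
  rewrite -(ler_nat R) !natrM; move: le_d; rewrite -natr1 lerD2r.
  by rewrite ler_pdivlMr ?ltr0n // mulrC.
- move=> s s_ge2 lt_sa lt_bd; exists (fun=> 0); first exact: cvg_cst.
  rewrite qualifE; apply/asboolP.
  pose c : R := (64 * b ^ 4)%:R.
  have c_gt0 : 0 < c by rewrite ltr0n muln_gt0 expn_gt0 b_gt0.
  exists c^-1; first by rewrite invr_gt0.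
  exists (2 * 4 ^ b.+1)%N => // n /= le_n.
  have := extremal_lower_bound a_gt0 le_ab s_ge2 lt_bd le_n.
  move: (extremal _ _ _) => E; rewrite -(ler_nat R) !natrX natrM -/c => le_E.
  rewrite subr0 ger0_norm ?powR_ge0 // ger0_norm ?ler0n //.
  (* Squaring both sides turns the real power of exponent 3/2 into [n ^ 3]. *)
  rewrite ler_pdivrMl // -(@ler_pXn2r _ 2) ?nnegrE ?powR_ge0 ?mulr_ge0 ?(ltW c_gt0) //.
  apply: le_trans le_E; rewrite -powR_mulrn ?powR_ge0 // -powRrM.
  by rewrite mulfVK ?pnatr_eq0 // powR_mulrn.
Qed.
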